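(* For every fixed $c\ge1$, there is a constant $C_c$ such that, for every choice of positive edge activities $\lambda$ and every set of $c$-rough hole weights $w$, $$\tau_{\mathrm{rel}}\bigl(P^{\mathrm B}_{\mathrm{JSV}}(\lambda,w)\bigr)\le C_c\,n^3\log n .$$
   Context: Let $V_1,V_2$ be disjoint sets with $|V_1|=|V_2|=n$. In the complete bipartite graph on $(V_1,V_2)$ let $\mathcal P$ be the set of perfect matchings, let $\mathcal N(u,v)$ (for $(u,v)\in V_1\times V_2$) be the set of matchings with $n-1$ edges whose unmatched vertices (holes) are exactly $u$ and $v$, and let $\Omega=\mathcal P\cup\bigcup_{u,v}\mathcal N(u,v)$. Positive edge activities are a function $\lambda:V_1\times V_2\to(0,\infty)$; put $\lambda(M)=\prod_{e\in M}\lambda(e)$ and $\lambda(S)=\sum_{M\in S}\lambda(M)$ for $S\subseteq\Omega$. The constant $C_c$ depends only on $c$. Ideal hole weights: $w^*(u,v)=\lambda(\mathcal P)/\lambda(\mathcal N(u,v))$. Positive hole weights $w:V_1\times V_2\to(0,\infty)$ are $c$-rough if $c^{-1}\le w(u,v)/w^*(u,v)\le c$ for all $(u,v)$. Moves (adjacency $M\sim M'$, symmetric): add/delete: $M\in\mathcal P$ and $M\setminus\{(u,v)\}\in\mathcal N(u,v)$ for $(u,v)\in M$ are adjacent; slides: $M\in\mathcal N(u,v)$ is adjacent, for each $(x,y)\in M$, to $M\setminus\{(x,y)\}\cup\{(x,v)\}\in\mathcal N(u,y)$ and to $M\setminus\{(x,y)\}\cup\{(u,y)\}\in\mathcal N(x,v)$.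 Boosted JSV chain: $\pi^{\mathrm B}_{\lambda,w}$ is the probability distribution on $\Omega$ proportional to $n^2\lambda(M)$ for $M\in\mathcal P$ and to $w(u,v)\lambda(M)$ for $M\in\mathcal N(u,v)$. With $\pi=\pi^{\mathrm B}_{\lambda,w}$, the transition matrix $P^{\mathrm B}_{\mathrm{JSV}}=P^{\mathrm B}_{\mathrm{JSV}}(\lambda,w)$ has $P^{\mathrm B}_{\mathrm{JSV}}(M,M')=\frac1{4n}\min\{1,\pi(M')/\pi(M)\}$ for $M\sim M'$, zero for distinct nonadjacent states, and the remaining probability on the self-loop. It is lazy and reversible with respect to $\pi$. Relaxation time: for a reversible irreducible chain $P$ with stationary distribution $\pi$, $\tau_{\mathrm{rel}}(P)$ is the smallest $C>0$ with $\operatorname{Var}_\pi[f]\le C\,\mathcal E_P(f,f)$ for all $f:\Omega\to\mathbb R$, where $\mathcal E_P(f,f)=\frac12\sum_{x,y}\pi(x)P(x,y)(f(x)-f(y))^2$ (i.e. the inverse spectral gap).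
   Formalization: The bound is stated for n ≥ 2: at n = 1 the right-hand side is C_c·log 1 = 0 while the two-state chain has positive relaxation time (n = 0 is undefined), so the claim as written fails there. *)

(* Defs.v *)
From mathcomp Require Import all_boot all_order all_algebra.
From mathcomp Require Import boolp classical_sets reals constructive_ereal ereal.
From mathcomp Require Import exp.

Set Implicit Arguments.
Unset Strict Implicit.
Unset Printing Implicit Defensive.

Import Order.TTheory GRing.Theory Num.Theory.

Local Open Scope ring_scope.

Section RelaxationTime.
Variables (R : realType) (T : finType).
Implicit Types (pi f : T -> R) (P : T -> T -> R) (C : R).

Definition mean pi f : R := \sum_x pi x * f x.

Definition variance pi f : R := \sum_x pi x * (f x - mean pi f) ^+ 2.

Definition dirichlet P pi f : R :=
  2^-1 * \sum_x \sum_y pi x * P x y * (f x - f y) ^+ 2.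

Definition poincare P pi C : Prop :=
  forall f, variance pi f <= C * dirichlet P pi f.

(* The infimum is taken in [\bar R] so that a chain satisfying no Poincare
   inequality has relaxation time [+oo]; otherwise, for a state space with at
   least two points charged by pi, it is attained. *)
Definition relaxation_time P pi : \bar R :=
  ereal_inf [set C%:E | C in [set C | 0 < C /\ poincare P pi C]]%classic.

End RelaxationTime.

(* The two sides of the bipartition are distinct types, hence disjoint, and an
   edge is an element of [V1 * V2].  All notions below are meant for
   [#|V1| = #|V2| = n], and [#|V1|] plays the role of n. *)
Section Matchings.
Variables (V1 V2 : finType).
Implicit Types (M : {set V1 * V2}) (u x : V1) (v y : V2).

Definition matching M : bool :=
  [forall e in M, forall e' in M,
     (e.1 == e'.1) || (e.2 == e'.2) ==> (e == e')].

Definition matched1 M x : bool := [exists y, (x, y) \in M].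
Definition matched2 M y : bool := [exists x, (x, y) \in M].

Definition perfect_matchings : {set {set V1 * V2}} :=
  [set M | [&& matching M, [forall x, matched1 M x] & [forall y, matched2 M y]]].

Definition near_matchings u v : {set {set V1 * V2}} :=
  [set M | [&& matching M, #|M| == #|V1|.-1,
               [forall x, ~~ matched1 M x == (x == u)] &
               [forall y, ~~ matched2 M y == (y == v)]]].

Definition Omega : {set {set V1 * V2}} :=
  perfect_matchings :|: \bigcup_u \bigcup_v near_matchings u v.

Definition deletion M M' : bool :=
  (M \in perfect_matchings) && [exists e in M, M' == M :\ e].

Definition slide M M' : bool :=
  [exists u, exists v, (M \in near_matchings u v) &&
     [exists e in M, (M' == (e.1, v) |: (M :\ e))
                  || (M' == (u, e.2) |: (M :\ e))]].

(* [slide] needs no symmetrization: it is undone by sliding the new edge. *)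
Definition adjacent M M' : bool :=
  [|| deletion M M', deletion M' M | slide M M'].

End Matchings.

Notation state V1 V2 := {M : {set V1 * V2} | M \in Omega V1 V2}.

Section BoostedJSV.
Variables (R : realType) (V1 V2 : finType).
Implicit Types (lam w : V1 * V2 -> R) (M : {set V1 * V2}).
Implicit Types (S : {set {set V1 * V2}}).

Definition activity lam M : R := \prod_(e in M) lam e.

Definition total_activity lam S : R := \sum_(M in S) activity lam M.

Definition ideal_hole_weight lam (h : V1 * V2) : R :=
  total_activity lam (perfect_matchings V1 V2) /
  total_activity lam (near_matchings h.1 h.2).

Definition rough (c : R) lam w : Prop :=
  forall h, c^-1 <= w h / ideal_hole_weight lam h <= c.

(* A near-perfect matching has a unique pair of holes, so the sum over h has
   exactly one term when M is in Omega and is not perfect. *)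
Definition boosted_weight lam w M : R :=
  if M \in perfect_matchings V1 V2 then #|V1|%:R ^+ 2 * activity lam M
  else \sum_(h | M \in near_matchings h.1 h.2) w h * activity lam M.

Definition boosted_pi lam w (s : state V1 V2) : R :=
  boosted_weight lam w (val s) /
  \sum_(t : state V1 V2) boosted_weight lam w (val t).

Definition boosted_move lam w (s t : state V1 V2) : R :=
  if adjacent (val s) (val t) then
    (4 * #|V1|%:R)^-1 * Num.min 1 (boosted_pi lam w t / boosted_pi lam w s)
  else 0.

Definition boosted_JSV lam w (s t : state V1 V2) : R :=
  if s == t then 1 - \sum_(r | r != s) boosted_move lam w s r
  else boosted_move lam w s t.

End BoostedJSV.

(* Main.v *)
(** Identify the two sides.  A perfect matching is a permutation s, and a
near-perfect one is a permutation s together with a vertex u whose edge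
(u, s u) has been removed, so that its holes are u and s u; a slide replaces s
by s o (u z).  The union of two permutations (s, t) splits into alternating
cycles, and exchanging s and t on some of these cycles preserves the weight
lam(s) lam(t).

1. The pairs obtained from (s, t) by exchanging cycles form a cube on which
   (s, t) and (t, s) are antipodal.  The quadrilateral inequality on the cube
   bounds the variance on perfect matchings by the differences f(s) - f(s'),
   where s' is s exchanged with t on a single cycle.  No factor is lost for the
   number of cycles, and starting the route from s to s' at a uniform vertex of
   the cycle cancels the factor of Cauchy-Schwarz for its length.
2. A near-perfect matching (s, u) and a perfect one t are joined through the
   exchange s' of s and t on the cycle of u: when s and t are independent, s'
   is again distributed as a perfect matching.
3. Both routes slide along a single cycle.  The i-th state A of such a route
   from u, with x the i-th vertex of the cycle, is the first component of the
   pair (A, B) obtained from (s o (u x), t) by an exchange on the cycle of x.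
   This map is injective, and its change of weight involves only the edges at u
   and x, which bounds the load of each state.

The resulting bound is of order n^3, and ln n is bounded below for n >= 2. *)

Require Import Defs.
From mathcomp Require Import boolp classical_sets reals constructive_ereal ereal.
From mathcomp Require Import exp.
From mathcomp Require Import all_boot all_order all_algebra all_fingroup.
From mathcomp Require Import ring lra.

Set Implicit Arguments.
Unset Strict Implicit.
Unset Printing Implicit Defensive.

Import Order.TTheory GRing.Theory Num.Theory.

Local Open Scope ring_scope.

(** * Alternating cycles of a pair of permutations, and exchanges along them *)

Section ExchangeOfComponents.
Variable T : finType.
Implicit Types (s t : {perm T}) (p q : {perm T} * {perm T}) (u x y z : T).
Implicit Types (J : {set T}).
Local Open Scope group_scope.

(** Vertices stand for one side of the bipartition; [x] and [y] are linked when edges at them from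
    different permutations meet on the other side. The classes are the alternating cycles. *)
Definition link p : rel T := fun x y => (p.1 x == p.2 y) || (p.2 x == p.1 y).

Definition component p x := fingraph.root (link p) x.


Lemma link_sym p : connect_sym (link p).
Proof.
apply: sym_connect_sym => x y.
by rewrite /link /= orbC eq_sym [p.1 x == _]eq_sym.
Qed.

Lemma component_eq p x y :
  (component p x == component p y) = connect (link p) x y.
Proof. exact/root_connect/link_sym. Qed.

Lemma component_id p x : component p (component p x) = component p x.
Proof. exact/root_root/link_sym. Qed.

Lemma component_link p x y : p.1 x = p.2 y -> component p x = component p y.
Proof.
by move=> xy; apply/eqP; rewrite component_eq connect1 // /link xy eqxx.
Qed.

Lemma eq_component p q : link p =2 link q -> component p =1 component q.
Proof. exact: eq_root. Qed.

Definition exchange_fun J p z := if component p z \in J then p.2 z else p.1 z.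

(** Equal images under different members of the pair force a link, hence a common component, on
    which a single member is used. *)
Lemma exchange_fun_inj J p : injective (exchange_fun J p).
Proof.
move=> x y; rewrite /exchange_fun; case: ifP => xJ; case: ifP => yJ.
- exact: perm_inj.
- by move=> /esym/component_link yx; move: yJ; rewrite yx xJ.
- by move=> /component_link xy; move: xJ; rewrite xy yJ.
- exact: perm_inj.
Qed.

(** Components are named by their roots, so elements of [J] that are not roots have no effect. *)
Definition exchange J p : {perm T} * {perm T} :=
  locked (perm (@exchange_fun_inj J p), perm (@exchange_fun_inj (~: J) p)).

Lemma exchangeE J p z :
  ((exchange J p).1 z = if component p z \in J then p.2 z else p.1 z) *
  ((exchange J p).2 z = if component p z \in J then p.1 z else p.2 z).
Proof.
by split; rewrite /exchange -lock permE /exchange_fun ?inE //; case: (_ \in J).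
Qed.

(** Inside a component the exchange at most swaps the two alternatives of [link]; vertices of
    different components share no image, so no new link arises. *)
Lemma component_exchange J p : component (exchange J p) =1 component p.
Proof.
apply: eq_component => x y; rewrite /link !exchangeE.
have [xy|nxy] := eqVneq (component p x) (component p y).
  by rewrite xy; case: ifP => //; rewrite orbC.
have no_link a b : component p a != component p b -> (p.1 a == p.2 b) = false.
  by apply: contraNF => /eqP/component_link->.
have nyx : component p y != component p x by rewrite eq_sym.
have neq a b : component p a != component p b -> forall s, (s a == s b) = false.
  by move=> nab s; rewrite (inj_eq perm_inj); apply: contraNF nab => /eqP->.
by case: ifP => _; case: ifP => _; rewrite ?(eq_sym (p.2 x)) ?no_link ?neq.
Qed.

Lemma exchange_component J p x : component (exchange J p) x = component p x.
Proof. exact: component_exchange. Qed.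

Lemma perm_pairP p q : p.1 =1 q.1 -> p.2 =1 q.2 -> p = q.
Proof. by case: p q => [s t] [s' t'] /permP/= -> /permP/= ->. Qed.

Lemma exchangeK J : involutive (exchange J).
Proof.
by move=> p; apply: perm_pairP => z; rewrite !(exchangeE, exchange_component);
  case: (_ \in J).
Qed.

Lemma exchangeU J x p : x \notin J ->
  exchange (x |: J) p = exchange J (exchange [set x] p).
Proof.
move=> xJ; apply: perm_pairP => z;
  rewrite !(exchangeE, exchange_component) !inE;
  by have [->|] := eqVneq (component p z) x; rewrite ?(negPf xJ) //=;
     case: (_ \in J).
Qed.

Lemma exchangeC J K p : exchange J (exchange K p) = exchange K (exchange J p).
Proof.
by apply: perm_pairP => z; rewrite !(exchangeE, exchange_component);
  case: (_ \in J); case: (_ \in K).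
Qed.

Lemma exchange0 p : exchange finset.set0 p = p.
Proof. by apply: perm_pairP => z; rewrite !exchangeE inE. Qed.

Lemma exchangeT p : exchange finset.setT p = (p.2, p.1).
Proof. by apply: perm_pairP => z; rewrite !exchangeE inE. Qed.

Lemma exchange_nonroot p x : component p x != x -> exchange [set x] p = p.
Proof.
move=> nrx; apply: perm_pairP => z; rewrite exchangeE inE;
  by case: eqVneq => // zx; move: nrx; rewrite -zx component_id eqxx.
Qed.

Definition exchange_at x p := exchange [set component p x] p.

Lemma exchange_at_component x p z :
  component (exchange_at x p) z = component p z.
Proof. exact: exchange_component. Qed.

Lemma exchange_atE x p z :
  ((exchange_at x p).1 z =
     if component p z == component p x then p.2 z else p.1 z) *
  ((exchange_at x p).2 z =
     if component p z == component p x then p.1 z else p.2 z).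
Proof. by split; rewrite /exchange_at exchangeE inE. Qed.

Lemma exchange_atK x : involutive (exchange_at x).
Proof.
move=> p; rewrite [LHS]/exchange_at exchange_at_component.
exact: exchangeK.
Qed.

(** * Transpositions, and walks along the cycle of a vertex *)

Definition transp u x p : {perm T} * {perm T} := (tperm u x * p.1, p.2).

Lemma transpK u x : involutive (transp u x).
Proof. by case=> s t; rewrite /transp /= mulgA tperm2 mul1g. Qed.

(** Products apply the left factor first: follow [p.1] across, then return along [p.2]. *)
Definition step p : {perm T} := p.1 * p.2^-1.
Definition node p u i := iter i (step p) u.
(** The nodes of index 1 to [i]; the start [u] is left out. *)
Definition arc p u i := traject (step p) (step p u) i.
Definition cycle_length p u := fingraph.order (step p) u.

Lemma nodeS p u i : p.2 (node p u i.+1) = p.1 (node p u i).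
Proof. by rewrite /node iterS permM permKV. Qed.

Lemma component_node p u i : component p (node p u i) = component p u.
Proof. by elim: i => // i <-; apply/esym/component_link; rewrite nodeS. Qed.

Lemma cycle_length_gt0 p u : (0 < cycle_length p u)%N.
Proof. exact: fingraph.order_gt0. Qed.

Lemma cycle_length_le p u : (cycle_length p u <= #|T|)%N.
Proof. exact: max_card. Qed.

Lemma node_cycle_length p u : node p u (cycle_length p u) = u.
Proof. exact/iter_order/perm_inj. Qed.

Lemma node_inj p u i j : (i < cycle_length p u)%N -> (j < cycle_length p u)%N ->
  node p u i = node p u j -> i = j.
Proof.
move=> ik jk; have nthE m : (m < cycle_length p u)%N ->
  node p u m = nth u (fingraph.orbit (step p) u) m.
  by move=> mk; rewrite /fingraph.orbit nth_traject.
rewrite !nthE // => /eqP; rewrite nth_uniq ?fingraph.size_orbit //.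
by move/eqP.
Qed.

(** Links also go backwards, but forward reachability under a permutation of a finite set is
    symmetric. *)
Lemma component_fconnect p u z :
  (component p u == component p z) = fconnect (step p) u z.
Proof.
apply/idP/idP; last first.
  rewrite fconnect_orbit => /trajectP[i _ ->].
  by rewrite -/(node p u i) component_node.
rewrite component_eq; apply: connect_sub => {u z} x y; rewrite /link.
case/orP => /eqP xy.
  by apply/connect1; rewrite /= permM xy permK.
rewrite fconnect_sym; last exact: perm_inj.
by apply/connect1; rewrite /= permM -xy permK.
Qed.

Lemma component_nodeP p u z : reflect
  (exists2 i, (i < cycle_length p u)%N & z = node p u i)
  (component p z == component p u).
Proof.
by rewrite eq_sym component_fconnect fconnect_orbit; apply: trajectP.
Qed.

Lemma cycle_lengthE p u :
  cycle_length p u = #|[pred z | component p z == component p u]|.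
Proof. by apply: eq_card => z; rewrite !inE eq_sym component_fconnect. Qed.

Lemma arcP p u i z :
  reflect (exists2 j, (0 < j <= i)%N & z = node p u j) (z \in arc p u i).
Proof.
apply: (iffP trajectP) => [[j ji ->]|[[|j]// ji ->]].
  by exists j.+1; rewrite // /node iterSr.
by exists j; rewrite // /node iterSr.
Qed.

Section Split.
Variables (p : {perm T} * {perm T}) (u : T).
Notation k := (cycle_length p u).

Lemma node_eq0 i : (i < k)%N -> (node p u i == u) = (i == 0)%N.
Proof.
move=> ik; apply/eqP/eqP => [iu|->//].
by apply: (@node_inj p u) => //; apply: cycle_length_gt0.
Qed.

Lemma node_eq i j : (i < k)%N -> (j < k)%N ->
  (node p u i == node p u j) = (i == j).
Proof. by move=> ik jk; apply/eqP/eqP => [|->//]; apply: node_inj. Qed.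

Lemma notin_arc i : (i < k)%N -> u \notin arc p u i.
Proof.
move=> ik; apply/arcP => -[j /andP[j0 ji]] /esym/eqP.
by rewrite node_eq0 ?(leq_ltn_trans ji) //; case: j j0 {ji}.
Qed.

Lemma transpE x z : (transp u x p).1 z = p.1 (tperm u x z).
Proof. by rewrite permM. Qed.

Lemma transp_node i j : (0 < j < i)%N -> (i < k)%N ->
  (transp u (node p u i) p).1 (node p u j) = p.1 (node p u j).
Proof.
move=> /andP[j0 ji] ik; have jk := ltn_trans ji ik; rewrite transpE tpermD //.
  by rewrite eq_sym node_eq0 // -lt0n.
by rewrite node_eq // gtn_eqF.
Qed.

(* Composing with the transposition of u and the i-th node of its cycle splits
   off the nodes 1, ..., i as a component. *)
Lemma component_transp i z : (0 < i < k)%N ->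
  let x := node p u i in
  (component (transp u x p) z == component (transp u x p) x) =
    (z \in arc p u i).
Proof.
move=> /andP[i0 ik] x; set q := transp u x p.
have q1x : q.1 x = p.1 u by rewrite transpE tpermR.
have q2 : q.2 = p.2 by [].
apply/idP/idP => [zx | /arcP[[|j]// ji ->{z}]].
  have xarc : x \in arc p u i by apply/arcP; exists i; rewrite ?i0 /=.
  suff cl : closed (link q) (arc p u i).
    by rewrite -(closed_connect cl (x := x)) // -component_eq eq_sym.
  apply: intro_closed => [|a b ab /arcP[[|j]// ji aE]]; first exact: link_sym.
  have jk : (j < k)%N by apply: leq_trans ik; apply: leqW; move: ji.
  apply/arcP; case/orP: ab => /eqP; rewrite {}aE => ab.
    have [ji'|ji'] := eqVneq j.+1 i.
      exists 1%N; first by rewrite i0.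
      apply/(@perm_inj _ p.2); rewrite nodeS.
      by move: ab; rewrite ji' -/x q1x.
    have {ji'} ji' : (j.+1 < i)%N by rewrite ltn_neqAle ji'.
    exists j.+2 => //; apply/(@perm_inj _ p.2); rewrite nodeS.
    by rewrite -(@transp_node i).
  move: ab; rewrite q2 nodeS transpE => /perm_inj ab.
  have -> : b = tperm u x (node p u j) by rewrite ab tpermK.
  case: j ji jk {ab} => [|j] ji jk.
    by exists i; rewrite ?i0 ?leqnn ?tpermL.
  exists j.+1; first exact: ltnW.
  rewrite tpermD // 1?eq_sym ?node_eq0 //.
  by rewrite node_eq // ltn_eqF.
elim: j ji => [_|j IHj ji].
  by apply/eqP/esym/component_link; rewrite q1x q2 nodeS.
rewrite -(eqP (IHj _)); last exact: ltnW.
by apply/eqP/esym/component_link; rewrite q2 transp_node // nodeS.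
Qed.

Lemma component_transp_neq x : x != u -> component p x == component p u ->
  component (transp u x p) u != component (transp u x p) x.
Proof.
move=> xu /component_nodeP[i ik xE].
move: xu; rewrite xE node_eq0 // -lt0n => i0.
by rewrite component_transp ?i0 // notin_arc.
Qed.

(** Without its edge at [u], the [i]-th state has holes [u] and [p.1 (node p u i)]. By [nodeS] the
    latter is the [p.2]-image of the next node, so one slide gives that node its edge of [p.2]. *)
Fixpoint slide_path i : {perm T} :=
  if i is j.+1 then tperm u (node p u i) * slide_path j else p.1.

Lemma slide_pathE i z : (i < k)%N ->
  slide_path i z =
    if z == u then p.1 (node p u i)
    else if z \in arc p u i then p.2 z else p.1 z.
Proof.
elim: i z => [|i IHi] z ik /=; first by case: eqP => [->|].
have ik' := ltnW ik; rewrite permM IHi //.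
have xu : (node p u i.+1 == u) = false by rewrite node_eq0.
have xarc : node p u i.+1 \in arc p u i = false.
  apply/negP => /arcP[j /andP[_ ji] /eqP].
  by rewrite node_eq ?gtn_eqF // (leq_ltn_trans ji).
have [->|zu] := eqVneq z u; first by rewrite tpermL xu xarc.
rewrite /arc trajectSr mem_rcons inE -/(arc p u i) -iterSr -/(node p u i.+1).
have [->|zx] := eqVneq z (node p u i.+1); first by rewrite tpermR eqxx nodeS.
by rewrite tpermD ?(negPf zu) // eq_sym.
Qed.

(** The arc walked so far is a whole component of the transposed pair, so walking it amounts to one
    exchange there. In this form [p] can be recovered from the exchanged pair and the node. *)
Lemma slide_path_exchange i : (0 < i < k)%N ->
  slide_path i = (exchange_at (node p u i) (transp u (node p u i) p)).1.
Proof.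
move=> /andP[i0 ik]; apply/permP => z.
rewrite exchange_atE component_transp ?i0 // slide_pathE // transpE /=.
have [->|zu] := eqVneq z u; first by rewrite (negPf (notin_arc ik)) tpermL.
case: ifPn => // zarc; rewrite tpermD 1?eq_sym //.
by apply: contraNneq zarc => ->; apply/arcP; exists i; rewrite ?i0 /=.
Qed.

(** After [k - 1] slides every other node of the cycle carries its edge of [p.2], and the value left
    at [u] is [p.2 u] because the walk closes up. *)
Lemma slide_path_last : slide_path k.-1 = (exchange_at u p).1.
Proof.
have k0 : (k.-1 < k)%N by rewrite ltn_predL cycle_length_gt0.
apply/permP => z; rewrite exchange_atE slide_pathE //.
have [->|zu] := eqVneq z u.
  by rewrite eqxx -nodeS prednK ?cycle_length_gt0 // node_cycle_length.
congr (if _ then _ else _); apply/arcP/component_nodeP => -[j].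
  move=> /andP[_ jk] ->; exists j => //; exact: leq_ltn_trans jk k0.
move=> jk zE; exists j => //; move: zu; rewrite zE node_eq0 // -lt0n => -> /=.
by rewrite -ltnS prednK ?cycle_length_gt0.
Qed.

End Split.

Lemma exchange_transp_holes u x p : x != u -> component p x == component p u ->
  let q := exchange_at x (transp u x p) in
  [/\ q.1 u = p.1 x, q.2 x = p.1 u & component q u != component q x].
Proof.
move=> xu xu_p /=; have ux := component_transp_neq xu xu_p.
split; last by rewrite !exchange_at_component.
  by rewrite exchange_atE (negPf ux) transpE tpermL.
by rewrite exchange_atE eqxx transpE tpermR.
Qed.

Lemma transp_exchange_holes u x q : component q u != component q x ->
  let p := transp u x (exchange_at x q) in p.1 u = q.2 x /\ p.1 x = q.1 u.
Proof.
move=> ux /=; rewrite !permM tpermL tpermR !exchange_atE eqxx.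
by rewrite (negPf ux).
Qed.

Lemma transp_exchange_transp_holes u x q : component q u == component q x ->
  let p := transp u x (exchange_at x (transp u x q)) in
  p.1 u = q.2 x /\ p.2 x = q.1 u.
Proof.
move=> ux; rewrite /= permM tpermL !exchange_atE eqxx /=; split=> //.
by rewrite permM tpermR.
Qed.

End ExchangeOfComponents.

(** * Injective comparison of sums, and Cauchy-Schwarz along a path *)

Section FiniteSums.
Variable R : realFieldType.

Lemma sum_le_inj (I J : finType) (h : I -> J) (P : pred I) (Q : pred J)
    (F : I -> R) (G : J -> R) :
  injective h -> (forall i, P i -> Q (h i)) ->
  (forall i, P i -> F i <= G (h i)) ->
  (forall j, Q j -> 0 <= G j) -> \sum_(i | P i) F i <= \sum_(j | Q j) G j.
Proof.
move=> h_inj PQ FG G0; apply: (le_trans (ler_sum _ FG)).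
have -> : \sum_(i | P i) G (h i) = \sum_(j in h @: P) G j.
  by rewrite big_imset //= => x y _ _; apply: h_inj.
rewrite [leRHS](bigID (fun j => j \in h @: P)) /=.
rewrite [X in _ <= X + _](eq_bigl (fun j => j \in h @: P)); last first.
  by move=> j; apply/andb_idl => /imsetP[i Pi ->]; apply: PQ.
by rewrite lerDl sumr_ge0 // => j /andP[Qj _]; apply: G0.
Qed.

(** Cauchy-Schwarz in incremental form, so that a route can be extended at either end. *)
Lemma sqr_add_le (m S Q x : R) : 0 <= m -> 0 <= Q -> S ^+ 2 <= m * Q ->
  (S + x) ^+ 2 <= (m + 1) * (Q + x ^+ 2).
Proof.
move=> m_ge0 Q_ge0 SQ; have [m0|m_neq0] := eqVneq m 0.
  move: SQ; rewrite m0 mul0r => S2.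
  have /eqP -> : S == 0 by rewrite -sqrf_eq0 eq_le S2 sqr_ge0.
  by rewrite !add0r mul1r lerDr.
have m_gt0 : 0 < m by rewrite lt_def m_neq0.
rewrite -(ler_pM2l m_gt0) -subr_ge0.
(* [m] times the difference of the two sides is at least this square. *)
have := sqr_ge0 (S - m * x); nra.
Qed.

Lemma sqr_sum_le (m : nat) (a : nat -> R) :
  (\sum_(i < m) a i) ^+ 2 <= m%:R * \sum_(i < m) a i ^+ 2.
Proof.
elim: m => [|m IHm]; first by rewrite !big_ord0 expr0n mul0r.
rewrite !big_ord_recr /= -natr1 sqr_add_le ?ler0n //.
by rewrite sumr_ge0 // => i _; apply: sqr_ge0.
Qed.

Lemma telescope_sqr_le (m : nat) (a : nat -> R) :
  (a 0%N - a m) ^+ 2 <= m%:R * \sum_(i < m) (a i - a i.+1) ^+ 2.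
Proof.
suff -> : a 0%N - a m = \sum_(i < m) (a i - a i.+1) 
  by apply: (sqr_sum_le m (fun i => a i - a i.+1)).
elim: m => [|m IHm]; first by rewrite big_ord0 subrr.
by rewrite big_ord_recr -IHm /= addrA subrK.
Qed.

End FiniteSums.

(** * Activities of permutations and of pairs *)

Section Activities.
Variables (R : realFieldType) (T : finType) (lam : T * T -> R).
Hypothesis lam_gt0 : forall e, 0 < lam e.
Implicit Types (s t A B : {perm T}) (p q : {perm T} * {perm T}) (u v x y z : T).
Implicit Types (J : {set T}).

Definition act s := \prod_x lam (x, s x).
Definition act2 p := act p.1 * act p.2.
Definition total_act := \sum_s act s.
Definition edge_act u v := \sum_(s : {perm T} | s u == v) act s.

Lemma act_gt0 s : 0 < act s.
Proof. by apply: prodr_gt0. Qed.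

Lemma act_ge0 s : 0 <= act s. Proof. exact/ltW/act_gt0. Qed.

Lemma act2_ge0 p : 0 <= act2 p.
Proof. by rewrite mulr_ge0 ?act_ge0. Qed.

Lemma edge_act_gt0 u v : 0 < edge_act u v.
Proof.
rewrite /edge_act (bigD1 (tperm u v)) ?tpermL //=.
by rewrite ltr_pwDl ?act_gt0 // sumr_ge0 // => *; apply: act_ge0.
Qed.

Lemma edge_act_le u v : edge_act u v <= total_act.
Proof.
rewrite /total_act (bigID (fun s : {perm T} => s u == v)) /= lerDl.
by rewrite sumr_ge0 // => *; apply: act_ge0.
Qed.

Lemma total_act_gt0 : 0 < total_act.
Proof.
rewrite /total_act (bigD1 (perm_one T)) //=.
by rewrite ltr_pwDl ?act_gt0 // sumr_ge0 // => *; apply: act_ge0.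
Qed.

Lemma sum_edge_act u (g : T -> R) :
  \sum_(s : {perm T}) g (s u) * act s = \sum_v g v * edge_act u v.
Proof.
rewrite (partition_big (fun s : {perm T} => s u) predT) //=.
apply: eq_bigr => v _; rewrite mulr_sumr.
by apply: eq_bigr => s /eqP->.
Qed.

Lemma sum_act2 (g h : {perm T} -> R) :
  \sum_p g p.1 * h p.2 * act2 p = (\sum_s g s * act s) * (\sum_s h s * act s).
Proof.
rewrite -(pair_bigA _ (fun s t => g s * h t * (act s * act t))) /= mulr_suml.
apply: eq_bigr => s _; rewrite mulr_sumr; apply: eq_bigr => t _.
by rewrite mulrACA.
Qed.

Lemma sum_act2_fst (g : {perm T} -> R) :
  \sum_p act2 p * g p.1 = total_act * \sum_s act s * g s.
Proof.
have := sum_act2 g (fun=> 1).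
under eq_bigr do rewrite mulr1 mulrC; move=> ->; rewrite mulrC.
by congr (_ * _); apply: eq_bigr => s _; rewrite ?mul1r // mulrC.
Qed.

Lemma act2_exchange J p : act2 (exchange J p) = act2 p.
Proof.
rewrite /act2 /act -!big_split; apply: eq_bigr => z _.
by rewrite !exchangeE /=; case: (_ \in J); rewrite // mulrC.
Qed.

Lemma act2_exchange_at x p : act2 (exchange_at x p) = act2 p.
Proof. exact: act2_exchange. Qed.

Lemma act2_transp u x p :
  act2 (transp u x p) * (lam (u, p.1 u) * lam (x, p.1 x)) =
  act2 p * (lam (u, p.1 x) * lam (x, p.1 u)).
Proof.
case: p => s t; rewrite /act2 /=.
have [->|xu] := eqVneq x u; first by rewrite tperm1 mul1g.
have ux : u != x by rewrite eq_sym.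
suff : act (tperm u x * s)%g * (lam (u, s u) * lam (x, s x)) =
       act s * (lam (u, s x) * lam (x, s u)).
  by move=> e; rewrite mulrAC e mulrAC.
rewrite /act [X in X * _ = _](bigD1 u) // [X in _ * X * _ = _](bigD1 x) //=.
rewrite [X in _ = X * _](bigD1 u) // [X in _ = _ * X * _](bigD1 x) //=.
rewrite !permM tpermL tpermR (eq_bigr (fun z => lam (z, s z))).
  by ring.
by move=> z /andP[zu zx]; rewrite permM tpermD // eq_sym.
Qed.

Lemma exchange_sum J (g : {perm T} * {perm T} -> R) :
  \sum_p act2 p * g (exchange J p) = \sum_p act2 p * g p.
Proof.
rewrite [RHS](reindex_inj (inv_inj (exchangeK J))).
by apply: eq_bigr => p _; rewrite act2_exchange.
Qed.

Lemma exchange_at_sum x (g : {perm T} * {perm T} -> R) :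
  \sum_p act2 p * g (exchange_at x p) = \sum_p act2 p * g p.
Proof.
rewrite [RHS](reindex_inj (inv_inj (exchange_atK x))).
by apply: eq_bigr => p _; rewrite act2_exchange_at.
Qed.

(** * The cube of exchanges *)

Section Cube.
Variable f : {perm T} -> R.

Let gap (J : {set T}) := \sum_p act2 p * (f p.1 - f (exchange J p).1) ^+ 2.

(* The diagonals of a quadrilateral have a sum of squares at most that of its
   sides; its vertices are p and its exchanges along x, J and x |: J. *)
Lemma gapU1 J x : x \notin J -> gap (x |: J) <= gap J + gap [set x].
Proof.
move=> xJ.
(* Exchanges preserve [act2], so the base point of a gap may be moved. Each gap is then written
   twice, as two parallel sides or as the two diagonals. *)
have shifted K L :
  gap K = \sum_p act2 p *
    (f (exchange L p).1 - f (exchange K (exchange L p)).1) ^+ 2.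
  by rewrite (exchange_sum L (fun p => (f p.1 - f (exchange K p).1) ^+ 2)).
suff: gap (x |: J) + gap (x |: J) <=
      (gap J + gap J) + (gap [set x] + gap [set x]).
  lra.
rewrite {1}(shifted (x |: J) [set x]) {1}(shifted J [set x]).
rewrite {1}(shifted [set x] J) /gap -!big_split /=.
apply: ler_sum => p _; rewrite (exchangeC [set x] J) !exchangeU // exchangeK.
rewrite -!mulrDr ler_wpM2l ?act2_ge0 //.
set a := f p.1; set b := f _; set d := f _; set e := f _.
have := sqr_ge0 (a + e - b - d); nra.
Qed.

(** Vertices are added one by one. Which of them are roots depends on the pair; the others act
    trivially, so one index set serves all cubes. *)
Lemma gapT : gap [set: T] <= \sum_x gap [set x].
Proof.
suff gap_seq r : uniq r -> gap [set x in r] <= \sum_(x <- r) gap [set x].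
  have := gap_seq _ (enum_uniq T); rewrite big_enum /=.
  by congr (gap _ <= _); apply/setP => x; rewrite !inE mem_enum.
elim: r => [_|x r IHr /= /andP[xr r_uniq]].
  rewrite big_nil (_ : [set x in [::]] = finset.set0) ?set_nil //.
  by rewrite /gap big1 // => p _; rewrite exchange0 subrr expr0n mulr0.
rewrite big_cons set_cons addrC.
apply: (le_trans (gapU1 _)); first by rewrite inE.
by rewrite lerD2r IHr.
Qed.

(** A cycle is represented by a uniform vertex: each of its [k] vertices contributes [1/k]. *)
Lemma sum_components p (h : T -> R) : (forall x, h (component p x) = h x) ->
  \sum_(x | component p x == x) h x = \sum_u (cycle_length p u)%:R^-1 * h u.
Proof.
move=> h_component.
rewrite [RHS](partition_big (component p) (fun x => component p x == x)) /=;
  last first.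
  by move=> u _; rewrite component_id.
apply: eq_bigr => x /eqP rx.
rewrite [RHS](eq_bigr (fun=> (cycle_length p x)%:R^-1 * h x)) => [|u /eqP ux].
  rewrite big_const iter_addr_0 -[RHS]mulr_natl mulrA.
  rewrite (_ : #|_| = cycle_length p x); last first.
    by rewrite cycle_lengthE; apply: eq_card => z; rewrite !inE rx.
  by rewrite mulfV ?mul1r // pnatr_eq0 -lt0n cycle_length_gt0.
rewrite -(h_component u) ux; congr (_%:R^-1 * _); rewrite !cycle_lengthE.
by apply: eq_card => z; rewrite !inE rx ux.
Qed.

(** Exchanging everything turns [(s, t)] into [(t, s)], so the left side is the gap of the full
    set. *)
Lemma cube_le :
  \sum_p act2 p * (f p.1 - f p.2) ^+ 2 <=
  \sum_p act2 p * \sum_u (cycle_length p u)%:R^-1 *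
                            (f p.1 - f (exchange_at u p).1) ^+ 2.
Proof.
have := gapT; rewrite {1}/gap.
under eq_bigr do rewrite exchangeT /=.
move/le_trans; apply; rewrite exchange_big /=; apply: ler_sum => p _.
rewrite -mulr_sumr ler_wpM2l ?act2_ge0 //.
rewrite -(sum_components (h := fun u => (f p.1 - f (exchange_at u p).1) ^+ 2)).
  rewrite (bigID (fun x => component p x == x)) /= [X in _ + X]big1 ?addr0.
    by apply: ler_sum => x /eqP rx; rewrite /exchange_at rx.
  by move=> x rx; rewrite exchange_nonroot // subrr expr0n.
by move=> x; rewrite /exchange_at component_id.
Qed.

End Cube.

End Activities.

(** * Loads of the slide routes *)

Section Loads.
Variables (R : realFieldType) (T : finType) (lam : T * T -> R).
Hypothesis lam_gt0 : forall e, 0 < lam e.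
Implicit Types (s t A B : {perm T}) (p q : {perm T} * {perm T}) (u v x y z : T).

Notation pairT := ({perm T} * {perm T})%type.
Notation act := (act lam).
Notation act2 := (act2 lam).
Notation total_act := (total_act lam).
Notation edge_act := (edge_act lam).

Variables (omega : T -> R) (u : T).
Hypothesis omega_ge0 : forall v, 0 <= omega v.

(** Two choices of [omega] occur: the constant 1, for independent perfect matchings, and [w / lam]
    at [u], which makes the first permutation a near-perfect matching with hole [u]. *)
Definition weight p := omega (p.1 u) * act2 p.

Lemma weight_ge0 p : 0 <= weight p.
Proof. by rewrite mulr_ge0 ?act2_ge0. Qed.

Lemma weight_sum : \sum_p weight p = total_act * \sum_v omega v * edge_act u v.
Proof.
rewrite -sum_edge_act mulrC.
have := sum_act2 lam (fun s => omega (s u)) (fun=> 1).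
under eq_bigr do rewrite mulr1.
by move=> ->; congr (_ * _); apply: eq_bigr => s _; rewrite mul1r.
Qed.

(* The weight of a pair obtained from q by replacing, up to exchanges, the
   edges (u, q.1 u) and (x, q.2 x) with (u, q.2 x) and (x, q.1 u). *)
Definition swapped_weight x q := omega (q.2 x) * act2 q *
  (lam (u, q.2 x) * lam (x, q.1 u) / (lam (u, q.1 u) * lam (x, q.2 x))).

Lemma swapped_weight_ge0 x q : 0 <= swapped_weight x q.
Proof.
apply: mulr_ge0; first by rewrite mulr_ge0 ?act2_ge0.
by rewrite divr_ge0 // mulr_ge0 // ltW.
Qed.

Let lam_neq0 e : lam e != 0.
Proof. by rewrite gt_eqF. Qed.

Lemma transp_exchange_weight x q : component q u != component q x ->
  swapped_weight x q = weight (transp u x (exchange_at x q)).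
Proof.
move=> ux; have [p1u p1x] := transp_exchange_holes ux.
rewrite /swapped_weight /weight; set p := transp _ _ _ in p1u p1x *.
have := act2_transp lam u x p; rewrite {1}/p transpK act2_exchange_at p1u p1x.
move=> e; rewrite -mulrA; congr (_ * _).
by apply: (mulIf (mulf_neq0 (lam_neq0 (u, q.1 u)) (lam_neq0 (x, q.2 x))));
  rewrite -e -[LHS]mulrA divfK ?mulf_neq0.
Qed.

(** For [x != u] the first transposition splits the common component, so the exchange at [x] leaves
    the edges at [u] alone. *)
Lemma transp_exchange_transp_weight x q : component q u == component q x ->
  swapped_weight x q = weight (transp u x (exchange_at x (transp u x q))).
Proof.
move=> ux; have [p1u p2x] := transp_exchange_transp_holes ux.
rewrite /swapped_weight /weight; set p := transp _ _ _ in p1u p2x *.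
rewrite p1u -mulrA; congr (_ * _).
have [xu|xu] := eqVneq x u.
  have trp r : transp u x r = r.
    by case: r => s t; rewrite /transp xu tperm1 mul1g.
  rewrite /p !trp act2_exchange_at xu [lam (u, q.2 u) * _]mulrC.
  by rewrite divff ?mulr1 // mulf_neq0.
have e1 := act2_transp lam u x q.
have := act2_transp lam u x (exchange_at x (transp u x q)).
rewrite -/p act2_exchange_at !exchange_atE eqxx.
rewrite (negPf (component_transp_neq xu _)) 1?eq_sym //.
rewrite !transpE tpermL /= => e2.
apply: (mulIf (mulf_neq0 (lam_neq0 (u, q.1 u)) (lam_neq0 (x, q.2 x)))).
rewrite -[LHS]mulrA divfK ?mulf_neq0 //.
(* The activities of these intermediate edges cancel between the two transpositions. *)
apply: (mulIf (mulf_neq0 (lam_neq0 (x, q.1 x)) (lam_neq0 (u, q.1 x)))).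
transitivity (act2 q * (lam (u, q.1 x) * lam (x, q.1 u)) *
    (lam (u, q.2 x) * lam (x, q.1 x))); first by ring.
rewrite -e1.
transitivity (act2 (transp u x q) * (lam (u, q.2 x) * lam (x, q.1 x)) *
    (lam (u, q.1 u) * lam (x, q.1 x))); first by ring.
by rewrite -e2; ring.
Qed.

(** For each [p] exactly one [x], the preimage of [v], meets the condition, so summing over [x]
    costs no factor. *)
Lemma sum_weight_at (h : {perm T} * {perm T} -> {perm T}) v :
  \sum_x \sum_(p : pairT | h p x == v) weight p = \sum_p weight p.
Proof.
rewrite (exchange_big_dep predT) //=; apply: eq_bigr => p _.
rewrite (big_pred1 ((h p)^-1%g v)) // => x /=.
by rewrite -[RHS](inj_eq (@perm_inj _ (h p))) permKV.
Qed.

(* Whether u and x lie in the same component of q decides which of two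
   injections brings the swapped edges back to a pair of permutations. *)
Lemma swapped_weight_sum v :
  \sum_(q : pairT | q.1 u == v) \sum_x swapped_weight x q <=
    2 * \sum_p weight p.
Proof.
rewrite exchange_big mulr_natl mulr2n /=.
(* The factor 2 comes from the two cases: the recovered pair has [p.1 x = v] in one and [p.2 x = v]
   in the other. *)
rewrite -{1}(sum_weight_at fst v) -{1}(sum_weight_at snd v) -big_split /=.
apply: ler_sum => x _.
rewrite (bigID (fun q : pairT => component q u == component q x)) /= addrC.
apply: lerD.
  apply: (sum_le_inj (h := fun q : pairT => transp u x (exchange_at x q))).
  - exact: inj_comp (inv_inj (transpK _ _)) (inv_inj (exchange_atK _)).
  - by move=> q /andP[/eqP <- /transp_exchange_holes[_ ->]].
  - by move=> q /andP[_ /transp_exchange_weight->].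
  - by move=> p _; apply: weight_ge0.
apply: (sum_le_inj
  (h := fun q : pairT => transp u x (exchange_at x (transp u x q)))).
- by apply: inj_comp (inv_inj (transpK _ _)) _;
    apply: inj_comp (inv_inj (exchange_atK _)) (inv_inj (transpK _ _)).
- by move=> q /andP[/eqP <- /transp_exchange_transp_holes[_ ->]].
- by move=> q /andP[_ /transp_exchange_transp_weight->].
- by move=> p _; apply: weight_ge0.
Qed.

(** The sum is [act A] times a quantity [H] depending only on [A u]. The bound for all first
    permutations with this value at [u] is thus shared in proportion to [act]. *)
Lemma swapped_weight_sum_at A :
  \sum_(q : pairT | q.1 == A) \sum_x swapped_weight x q <=
    2 * (\sum_p weight p) * (act A / edge_act u (A u)).
Proof.
pose H v := \sum_(B : {perm T}) \sum_x omega (B x) * act B *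
  (lam (u, B x) * lam (x, v) / (lam (u, v) * lam (x, B x))).
have HE A' :
  \sum_(q : pairT | q.1 == A') \sum_x swapped_weight x q = act A' * H (A' u).
  rewrite /H mulr_sumr.
  rewrite (reindex_onto (fun B => (A', B)) snd) /=; last first.
    by case=> s t /= /eqP->.
  rewrite (eq_bigl predT) => [|B]; last by rewrite !eqxx.
  apply: eq_bigr => B _; rewrite mulr_sumr; apply: eq_bigr => x _.
  by rewrite /swapped_weight /act2 /=; ring.
rewrite HE [act A / _]mulrC mulrA [leRHS]mulrC ler_wpM2l ?act_ge0 //.
rewrite ler_pdivlMr ?edge_act_gt0 //.
apply: le_trans (swapped_weight_sum (A u)).
rewrite (partition_big (fun q : pairT => q.1) (fun s => s u == A u)) //=.
rewrite [leLHS]mulrC /edge_act mulr_suml; apply: ler_sum => s /eqP su.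
rewrite -su -HE le_eqVlt; apply/orP; left; apply/eqP.
by apply: eq_bigl => q; rewrite andbC; case: eqP => // ->; rewrite su eqxx.
Qed.

Definition load A :=
  \sum_p \sum_(0 <= i < cycle_length p u | slide_path p u i == A) weight p.

(** Routes starting at [A] give the first term. A later visit, at a node [x], is encoded by
    [moved x p]: its first component is [A], it determines [p] once [x] is known, and its
    [swapped_weight] is the weight of [p]. *)
Lemma load_le A :
  load A <= omega (A u) * act A * total_act +
            2 * (\sum_p weight p) * (act A / edge_act u (A u)).
Proof.
apply: le_trans (lerD (lexx _) (swapped_weight_sum_at A)).
have -> : omega (A u) * act A * total_act =
    \sum_(p : pairT | p.1 == A) weight p.
  rewrite (reindex_onto (fun B => (A, B)) snd) /=; last first.
    by case=> s t /= /eqP->.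
  rewrite (eq_bigl predT) => [|B]; last by rewrite !eqxx.
  rewrite /total_act mulr_sumr; apply: eq_bigr => B _.
  by rewrite /weight /act2 mulrA.
pose moved x p := exchange_at x (transp u x p).
pose visits x p :=
  [&& x != u, component p x == component p u & (moved x p).1 == A].
apply: (@le_trans _ _ (\sum_(p : pairT | p.1 == A) weight p +
    \sum_x \sum_(p | visits x p) weight p)).
  rewrite (exchange_big_dep predT) //= [X in _ <= X + _]big_mkcond.
  rewrite -big_split /=.
  apply: ler_sum => p _; rewrite big_ltn_cond ?cycle_length_gt0 //=.
  rewrite [leLHS](_ : _ = (if p.1 == A then weight p else 0) +
    \sum_(1 <= i < cycle_length p u | slide_path p u i == A) weight p);
    last first.
    by case: ifP; rewrite ?add0r.
  rewrite lerD2l (big_nat_widenl 1 0) // big_mkord.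
  apply: (sum_le_inj (h := fun i : 'I__ => node p u i)) => //.
  - by move=> i j /node_inj ij; apply/val_inj/ij.
  - move=> i /andP[/eqP iA i0]; have ik := ltn_ord i.
    rewrite /visits -iA component_node eqxx node_eq0 // -lt0n i0 /=.
    by rewrite [X in _ == X]slide_path_exchange ?i0.
  - by move=> x _; apply: weight_ge0.
rewrite lerD2l exchange_big /=; apply: ler_sum => x _.
apply: (sum_le_inj (h := moved x)).
- exact: inj_comp (inv_inj (exchange_atK _)) (inv_inj (transpK _ _)).
- by move=> p /and3P[].
- move=> p /and3P[xu ux _]; have [_ _ nux] := exchange_transp_holes xu ux.
  by rewrite transp_exchange_weight // exchange_atK transpK.
- by move=> q _; apply: swapped_weight_ge0.
Qed.

(** A slide is used only by routes through both of its ends, so its load is at most the load of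
    either; hence the minimum. *)
Lemma slides_le (W : {perm T} -> R) (K : R) (F : {perm T} -> R) :
  (forall A, load A <= K * W A) ->
  \sum_p weight p * \sum_(i < (cycle_length p u).-1)
    (F (slide_path p u i) - F (slide_path p u i.+1)) ^+ 2 <=
  K * \sum_A \sum_z Num.min (W A) (W (tperm u z * A)%g) *
                     (F A - F (tperm u z * A)%g) ^+ 2.
Proof.
move=> load_W; pose k p := cycle_length p u.
pose D (Az : {perm T} * T) := (F Az.1 - F (tperm u Az.2 * Az.1)%g) ^+ 2.
pose edge p i := (slide_path p u i, node p u i.+1).
pose through p Az := \sum_(i < (k p).-1 | edge p i == Az) weight p.
rewrite [leLHS](_ : _ = \sum_Az D Az * \sum_p through p Az); last first.
  under [RHS]eq_bigr do rewrite mulr_sumr.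
  rewrite exchange_big; apply: eq_bigr => p _.
  rewrite mulr_sumr (partition_big (fun i : 'I__ => edge p i) predT) //=.
  apply: eq_bigr => Az _; rewrite /through mulr_sumr.
  by apply: eq_bigr => i /eqP <-; rewrite mulrC.
rewrite pair_bigA mulr_sumr; apply: ler_sum => -[A z] _ /=.
rewrite [leLHS]mulrC [leRHS]mulrA /D /= ler_wpM2r ?sqr_ge0 //=.
have k_gt0 p : (0 < k p)%N by apply: cycle_length_gt0.
have through_le : \sum_p through p (A, z) <= load A.
  apply: ler_sum => p _; rewrite big_mkord.
  apply: (sum_le_inj (h := widen_ord (leq_pred (k p)))).
  - by move=> i j /(congr1 val) ij; apply: val_inj.
  - by move=> i /andP[].
  - by [].
  - by move=> *; apply: weight_ge0.
have through_le' : \sum_p through p (A, z) <= load (tperm u z * A)%g.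
  apply: ler_sum => p _; rewrite big_mkord.
  have ltk i : (i < (k p).-1 -> i.+1 < k p)%N by rewrite -ltnS prednK.
  apply: (sum_le_inj (h := fun i : 'I__ => Ordinal (ltk i (ltn_ord i)))).
  - by move=> i j /(congr1 val) [ij]; apply: val_inj.
  - by move=> i /eqP[<- <-] /=.
  - by [].
  - by move=> *; apply: weight_ge0.
by case: (leP (W A)) => _; apply: le_trans (load_W _).
Qed.

End Loads.

(** * The Poincare inequality in terms of permutations *)

Section PermutationChain.
Variables (R : realFieldType) (T : finType) (lam w : T * T -> R) (c : R).
Hypothesis lam_gt0 : forall e, 0 < lam e.
Hypothesis w_gt0 : forall h, 0 < w h.
Hypothesis c_ge1 : 1 <= c.
Implicit Types (s t A B : {perm T}) (p q : {perm T} * {perm T}) (u v x y z : T).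

Notation act := (act lam).
Notation act2 := (act2 lam).
Notation total_act := (total_act lam).
Notation edge_act := (edge_act lam).
Notation n := (#|T|%:R : R).

(** Here [edge_act u v / lam (u, v)] is the total activity of the near-perfect matchings with holes
    [u] and [v]. *)
Hypothesis w_rough : forall u v,
  c^-1 * total_act <= w (u, v) * (edge_act u v / lam (u, v)) <= c * total_act.

Definition near_weight s u := w (u, s u) * (act s / lam (u, s u)).

Variables (f : {perm T} -> R) (F : {perm T} -> T -> R).

Let c_gt0 : 0 < c. Proof. exact: lt_le_trans c_ge1. Qed.
Let total_gt0 : 0 < total_act. Proof. exact: total_act_gt0. Qed.

Lemma near_weight_gt0 s u : 0 < near_weight s u.
Proof. by rewrite mulr_gt0 // divr_gt0 // act_gt0. Qed.

(** Near-perfect matchings with the holes of [(s, u)] weigh together at least [total_act / c], and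
    the share of [(s, u)] is [act s / edge_act u (s u)]. *)
Lemma edge_share_le s u :
  total_act * (act s / edge_act u (s u)) <= c * near_weight s u.
Proof.
have /andP[lo _] := w_rough u (s u).
have e0 := edge_act_gt0 lam_gt0 u (s u).
rewrite mulrA ler_pdivrMr // [total_act * _]mulrC.
rewrite (_ : c * _ * _ =
  act s * (c * (w (u, s u) * (edge_act u (s u) / lam (u, s u))))); last first.
  by rewrite /near_weight; ring.
rewrite ler_wpM2l ?act_ge0 //.
by move: lo; rewrite mulrC ler_pdivrMr // mulrC.
Qed.

Lemma act_le_near s u : act s <= c * near_weight s u.
Proof.
apply: le_trans (edge_share_le s u).
rewrite mulrA ler_pdivlMr ?edge_act_gt0 // mulrC ler_wpM2r ?act_ge0 //.
exact: edge_act_le.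
Qed.

Lemma near_weight_sum_le u : \sum_s near_weight s u <= n * (c * total_act).
Proof.
rewrite (eq_bigr (fun s => w (u, s u) / lam (u, s u) * act s)) => [|s _];
  last by rewrite /near_weight; ring.
rewrite (sum_edge_act lam u (fun v => w (u, v) / lam (u, v))).
rewrite mulr_natl -[leRHS]sumr_const; apply: ler_sum => v _.
by have /andP[_] := w_rough u v; congr (_ <= _); ring.
Qed.

(** Under Metropolis rates the flow between two states is proportional to the minimum of their
    weights. *)
Definition deletion_energy : R :=
  \sum_s \sum_u Num.min (n ^+ 2 * act s) (near_weight s u) * (f s - F s u) ^+ 2.

Definition slide_energy_at u : R :=
  \sum_s \sum_z
    Num.min (near_weight s u) (near_weight (tperm u z * s)%g u) *
    (F s u - F (tperm u z * s)%g u) ^+ 2.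

Definition slide_energy : R := \sum_u slide_energy_at u.

Hypothesis n_ge1 : 1 <= n.

Lemma act_le_min s u : act s <= c * Num.min (n ^+ 2 * act s) (near_weight s u).
Proof.
case: (leP (n ^+ 2 * act s)) => _; last exact: act_le_near.
rewrite mulrA ler_peMl ?act_ge0 // mulr_ege1 // exprn_ege1 //.
Qed.

Lemma act_energy_le :
  \sum_u \sum_s act s * (f s - F s u) ^+ 2 <= c * deletion_energy.
Proof.
rewrite exchange_big mulr_sumr; apply: ler_sum => s _.
rewrite mulr_sumr; apply: ler_sum => u _.
by rewrite [leRHS]mulrA ler_wpM2r ?sqr_ge0 // act_le_min.
Qed.

Let moved u p := exchange_at u p.
Let track u p := \sum_(i < (cycle_length p u).-1)
  (F (slide_path p u i) u - F (slide_path p u i.+1) u) ^+ 2.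

Lemma track_ge0 u p : 0 <= track u p.
Proof. by rewrite sumr_ge0 // => i _; apply: sqr_ge0. Qed.

(** For a cycle of length [k] the route makes one deletion, [k - 1] slides and one addition; the
    Cauchy-Schwarz factor [k + 1], divided by [k], is at most 2. *)
Lemma cycle_route_le u p :
  (cycle_length p u)%:R^-1 * (f p.1 - f (moved u p).1) ^+ 2 <=
  2 * ((f p.1 - F p.1 u) ^+ 2 + track u p +
       (f (moved u p).1 - F (moved u p).1 u) ^+ 2).
Proof.
have := telescope_sqr_le (cycle_length p u).-1
  (fun i => F (slide_path p u i) u).
rewrite slide_path_last /= -/(moved u p) -/(track u p).
rewrite -{2}[cycle_length p u]prednK ?cycle_length_gt0 //.
set m := _.-1; set a := f p.1; set b := F p.1 u; set d := F _ u; set e := f _.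
set t := track u p => bd.
have m0 : 0 <= m%:R :> R by [].
have t0 : 0 <= t by apply: track_ge0.
rewrite mulrC ler_pdivrMr ?ltr0Sn // -natr1.
have bd_e := sqr_add_le (d - e) m0 t0 bd.
have Q0 : 0 <= t + (d - e) ^+ 2 by rewrite addr_ge0 ?sqr_ge0.
have := sqr_add_le (a - b) (addr_ge0 m0 ler01) Q0 bd_e.
rewrite (_ : b - d + _ + _ = a - e); last by ring.
move/le_trans; apply; rewrite -[(e - d) ^+ 2]sqrrN opprB.
have := mulr_ge0 m0 (addr_ge0 Q0 (sqr_ge0 (a - b))); lra.
Qed.

(** The hole fixes the start [u], so there is no average over the cycle and the number of moves, at
    most [n], is paid in full. *)
Lemma near_route_le u p :
  (F p.1 u - f (moved u p).1) ^+ 2 <=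
  n * (track u p + (f (moved u p).1 - F (moved u p).1 u) ^+ 2).
Proof.
have := telescope_sqr_le (cycle_length p u).-1
  (fun i => F (slide_path p u i) u).
rewrite slide_path_last /= -/(moved u p) -/(track u p).
have : ((cycle_length p u).-1.+1)%:R <= n.
  by rewrite prednK ?cycle_length_gt0 // ler_nat cycle_length_le.
rewrite -natr1; set m := _.-1%:R.
set b := F p.1 u; set d := F _ u; set e := f _.
set t := track u p => mn bd.
have t0 : 0 <= t by apply: track_ge0.
have := sqr_add_le (d - e) (ler0n _ _) t0 bd.
rewrite (_ : b - d + _ = b - e); last by ring.
move/le_trans; apply; rewrite -[(e - d) ^+ 2]sqrrN opprB.
by rewrite ler_wpM2r // addr_ge0 ?sqr_ge0.
Qed.

(** The constant 3 is 1 for the start of the route plus 2 for the encoded visits. *)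
Lemma act2_track_le u :
  \sum_p act2 p * track u p <= 3 * c * total_act * slide_energy_at u.
Proof.
have weight1 p : weight lam (fun=> 1) u p = act2 p by rewrite /weight mul1r.
have sum1 : \sum_p weight lam (fun=> 1) u p = total_act ^+ 2.
  rewrite weight_sum expr2; congr (_ * _).
  rewrite -(sum_edge_act lam u (fun=> 1)).
  by apply: eq_bigr => s _; rewrite mul1r.
under eq_bigr do rewrite -weight1.
apply: slides_le => // A; apply: (le_trans (load_le lam_gt0 _ _ _)) => //.
rewrite sum1 mul1r.
have h1 := act_le_near A u; have h2 := edge_share_le A u.
have h3 : total_act * act A <= total_act * (c * near_weight A u).
  by rewrite ler_pM2l.
have h4 : total_act * (total_act * (act A / edge_act u (A u))) <=
          total_act * (c * near_weight A u) by rewrite ler_pM2l.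
lra.
Qed.

(** The total weight is now at most [n * c * total_act ^+ 2], by summing over the second hole,
    whence the additional factor [n * c]. *)
Lemma near_track_le u :
  \sum_p near_weight p.1 u * act p.2 * track u p <=
    3 * c ^+ 2 * n * total_act * slide_energy_at u.
Proof.
pose om v := w (u, v) / lam (u, v).
have om_ge0 v : 0 <= om v by rewrite divr_ge0 // ltW.
have near_om s : near_weight s u = om (s u) * act s.
  by rewrite /near_weight /om; ring.
have weight_om p : weight lam om u p = near_weight p.1 u * act p.2.
  by rewrite /weight near_om mulrA.
have sum_om : \sum_p weight lam om u p <= total_act * (n * (c * total_act)).
  rewrite weight_sum ler_pM2l // -sum_edge_act.
  apply: le_trans (near_weight_sum_le u).
  by rewrite (eq_bigr (near_weight^~ u)) // => s _; rewrite near_om.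
under eq_bigr do rewrite -weight_om.
apply: slides_le => // A; apply: (le_trans (load_le lam_gt0 _ _ _)) => //.
rewrite -near_om; set S := \sum_p _ in sum_om *.
have h2 := edge_share_le A u.
set r := act A / _ in h2 *; set W := near_weight A u in h2 *.
have W0 : 0 < W by apply: near_weight_gt0.
have r0 : 0 <= r by rewrite divr_ge0 ?act_ge0 // ltW // edge_act_gt0.
have h3 : S * r <= total_act * (n * c) * (total_act * r).
  by rewrite mulrA -mulrA -[leRHS]mulrA -/S; have := ler_wpM2r r0 sum_om; lra.
have h4 : total_act * (n * c) * (total_act * r) <=
          total_act * (n * c) * (c * W).
  by rewrite ler_wpM2l // !mulr_ge0 // ltW.
have h5 : W * total_act <= c ^+ 2 * n * (W * total_act).
  apply: ler_peMl; first by rewrite mulr_ge0 // ltW.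
  by rewrite mulr_ege1 // exprn_ege1.
lra.
Qed.

Let avg := (\sum_s f s * act s) / total_act.

(** The mean square difference of two independent samples is twice the variance, here
    unnormalised. *)
Lemma two_point_variance :
  \sum_p act2 p * (f p.1 - f p.2) ^+ 2 =
  2 * total_act * \sum_s act s * (f s - avg) ^+ 2.
Proof.
set M := \sum_s act s * _.
have ME : M = \sum_s f s ^+ 2 * act s - (\sum_s f s * act s) ^+ 2 / total_act.
  rewrite /M (eq_bigr (fun s => f s ^+ 2 * act s - 2 * avg * (f s * act s) +
    avg ^+ 2 * act s)) => [|s _]; last by ring.
  rewrite !big_split /= sumrN -!mulr_sumr /avg -/total_act.
  by field; rewrite gt_eqF.
rewrite (eq_bigr (fun p => f p.1 ^+ 2 * 1 * act2 p -
    2 * (f p.1 * f p.2 * act2 p) + 1 * f p.2 ^+ 2 * act2 p)) => [|p _];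
  last by ring.
rewrite !big_split /= sumrN -mulr_sumr ME.
rewrite (sum_act2 lam (fun s => f s ^+ 2) (fun=> 1)) sum_act2.
rewrite (sum_act2 lam (fun=> 1) (fun s => f s ^+ 2)).
rewrite (eq_bigr act (F1 := fun s => 1 * act s)); last first.
  by move=> s _; rewrite mul1r.
by rewrite -/total_act; field; rewrite gt_eqF.
Qed.

Lemma perfect_variance_le :
  \sum_s act s * (f s - avg) ^+ 2 <= 3 * c * (deletion_energy + slide_energy).
Proof.
rewrite -(ler_pM2l (mulr_gt0 (ltr0n R 2) total_gt0)) -two_point_variance.
apply: (le_trans (cube_le lam_gt0 f)).
pose ends p u := (f p.1 - F p.1 u) ^+ 2.
apply: (@le_trans _ _ (\sum_u \sum_p
    act2 p * (2 * (ends p u + track u p + ends (moved u p) u)))).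
  rewrite exchange_big; apply: ler_sum => p _; rewrite mulr_sumr.
  by apply: ler_sum => u _; rewrite ler_wpM2l ?act2_ge0 // cycle_route_le.
(* The two end terms have equal sums because the exchange preserves [act2]: 4 is 2 + 2, and 6 is 2
   times the 3 of [act2_track_le]. *)
apply: (@le_trans _ _ (\sum_u
    (4 * total_act * (\sum_s act s * (f s - F s u) ^+ 2) +
     6 * c * total_act * slide_energy_at u))).
  apply: ler_sum => u _.
  have first_step : \sum_p act2 p * ends p u =
      total_act * \sum_s act s * (f s - F s u) ^+ 2.
    exact: (sum_act2_fst lam (fun s => (f s - F s u) ^+ 2)).
  have last_step : \sum_p act2 p * ends (moved u p) u =
      total_act * \sum_s act s * (f s - F s u) ^+ 2.
    by rewrite -first_step (exchange_at_sum lam u (ends^~ u)).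
  have slides := act2_track_le u.
  rewrite (eq_bigr (fun p => 2 * (act2 p * ends p u + act2 p * track u p +
     act2 p * ends (moved u p) u))) => [|p _]; last by ring.
  rewrite -mulr_sumr !big_split /= first_step last_step; lra.
rewrite big_split -!mulr_sumr /= -/slide_energy.
have := act_energy_le; set E := \sum_u _; set E1 := deletion_energy => h.
have h' : total_act * E <= total_act * (c * E1) by rewrite ler_pM2l.
have E10 : 0 <= total_act * (c * E1).
  apply: le_trans h'; apply: mulr_ge0; first exact: ltW.
  apply: sumr_ge0 => u _; apply: sumr_ge0 => s _.
  by rewrite mulr_ge0 ?sqr_ge0 ?act_ge0.
lra.
Qed.

Lemma deletion_energy_ge0 : 0 <= deletion_energy.
Proof.
apply: sumr_ge0 => s _; apply: sumr_ge0 => u _; rewrite mulr_ge0 ?sqr_ge0 //.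
by rewrite le_min mulr_ge0 ?act_ge0 ?exprn_ge0 // ltW // near_weight_gt0.
Qed.

Lemma slide_energy_ge0 : 0 <= slide_energy.
Proof.
apply: sumr_ge0 => u _; apply: sumr_ge0 => s _; apply: sumr_ge0 => z _.
by rewrite mulr_ge0 ?sqr_ge0 // le_min !ltW // near_weight_gt0.
Qed.

(** The exchange moves the edge of [p.1] at [u], with its factor [w / lam], to the second
    permutation; the first one is then weighted by [act] alone, independently of the second. *)
Lemma near_exchange_sum_le u (g : {perm T} -> R) : (forall s, 0 <= g s) ->
  \sum_p near_weight p.1 u * act p.2 * g (moved u p).1 <=
  n * c * total_act * \sum_s act s * g s.
Proof.
move=> g0; pose om v := w (u, v) / lam (u, v).
have near_om s : near_weight s u = om (s u) * act s.
  by rewrite /near_weight /om; ring.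
pose G q := om (q.2 u) * g q.1.
rewrite (eq_bigr (fun p => act2 p * G (moved u p))) => [|p _]; last first.
  by rewrite /G /moved near_om exchange_atE eqxx /act2; ring.
rewrite (exchange_at_sum lam u G) /G.
rewrite (eq_bigr (fun p => g p.1 * om (p.2 u) * act2 p)) => [|p _];
  last by ring.
rewrite (sum_act2 lam g (fun s => om (s u))) mulrC.
rewrite (eq_bigr (near_weight^~ u)) => [|s _]; last by rewrite near_om.
under [X in _ * X <= _]eq_bigr do rewrite mulrC.
rewrite ler_wpM2r //.
  by apply: sumr_ge0 => s _; rewrite mulr_ge0 ?act_ge0.
by apply: le_trans (near_weight_sum_le u) _; rewrite mulrA.
Qed.

(** [F s u - avg] is split at the perfect matching that ends the route: the route is charged to the
    energies, the rest to [perfect_variance_le]. *)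
Lemma near_variance_le :
  \sum_s \sum_u near_weight s u * (F s u - avg) ^+ 2 <=
  n ^+ 2 * (12 * c ^+ 2 * (deletion_energy + slide_energy)).
Proof.
rewrite -(ler_pM2l total_gt0) exchange_big mulr_sumr /=.
pose Su u := slide_energy_at u.
pose Du u := \sum_s act s * (f s - F s u) ^+ 2.
pose V := \sum_s act s * (f s - avg) ^+ 2.
apply: (@le_trans _ _ (\sum_u
    (2 * (n ^+ 2 * total_act) * (3 * c ^+ 2 * Su u + c * Du u) +
     2 * (n * c * total_act) * V))).
  apply: ler_sum => u _.
  pose nw p := near_weight p.1 u * act p.2.
  have nw0 p : 0 <= nw p by rewrite mulr_ge0 ?act_ge0 // ltW // near_weight_gt0.
  have -> : total_act * (\sum_s near_weight s u * (F s u - avg) ^+ 2) =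
      \sum_p nw p * (F p.1 u - avg) ^+ 2.
    rewrite mulrC mulr_suml.
    rewrite -(pair_bigA _ (fun s t =>
      near_weight s u * act t * (F s u - avg) ^+ 2)) /=.
    apply: eq_bigr => s _; rewrite mulr_sumr.
    by apply: eq_bigr => t _; rewrite mulrAC.
  apply: (@le_trans _ _ (\sum_p (2 * n * (nw p * track u p) +
      2 * n * (nw p * (f (moved u p).1 - F (moved u p).1 u) ^+ 2) +
      2 * (nw p * (f (moved u p).1 - avg) ^+ 2)))).
    apply: ler_sum => p _; have := near_route_le u p.
    set X := F p.1 u; set Y := f _; set Z := F _ u; set t := track u p => XY.
    rewrite (_ : _ + _ = nw p *
      (2 * (n * (t + (Y - Z) ^+ 2)) + 2 * (Y - avg) ^+ 2)); last by ring.
    rewrite ler_wpM2l //; have := sqr_ge0 ((X - Y) - (Y - avg)); lra.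
  rewrite !big_split -!mulr_sumr /=.
  have slides := near_track_le u.
  have lasts := near_exchange_sum_le u (fun s => sqr_ge0 (f s - F s u)).
  have vars := near_exchange_sum_le u (fun s => sqr_ge0 (f s - avg)).
  rewrite -/(Du u) in lasts; rewrite -/V in vars; rewrite -/(Su u) in slides.
  have n0 : 0 <= n by apply: le_trans n_ge1.
  have := ler_wpM2l n0 slides; have := ler_wpM2l n0 lasts.
  rewrite -/nw; lra.
(* [V] does not depend on [u], so the sum over [u] gives it its second factor [n]. *)
rewrite big_split /= -mulr_sumr sumr_const big_split /= -!mulr_sumr.
rewrite -[\sum_u Su u]/slide_energy.
have := act_energy_le; rewrite -[\sum_u \sum_s _]/(\sum_u Du u) => Dle.
have Vle := perfect_variance_le; rewrite -/V in Vle.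
rewrite -[X in _ + X]mulr_natr.
set E1 := deletion_energy in Dle Vle *; set E2 := slide_energy in Vle *.
have E1_ge0 : 0 <= E1 := deletion_energy_ge0.
have E2_ge0 : 0 <= E2 := slide_energy_ge0.
rewrite (_ : _ + _ = total_act * (n ^+ 2 *
  (6 * c ^+ 2 * E2 + 2 * (c * \sum_u Du u) + 2 * (c * V)))); last by ring.
rewrite ler_pM2l // ler_wpM2l ?sqr_ge0 //.
have c0 := ltW c_gt0.
have := ler_wpM2l c0 Dle; have := ler_wpM2l c0 Vle.
have := mulr_ge0 (sqr_ge0 c) E1_ge0; have := mulr_ge0 (sqr_ge0 c) E2_ge0.
rewrite expr2; lra.
Qed.

Lemma permutation_poincare :
  n ^+ 2 * (\sum_s act s * (f s - avg) ^+ 2) +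
  \sum_s \sum_u near_weight s u * (F s u - avg) ^+ 2 <=
  15 * c ^+ 2 * n ^+ 2 * (deletion_energy + slide_energy).
Proof.
apply: (le_trans
  (lerD (ler_wpM2l (sqr_ge0 _) perfect_variance_le) near_variance_le)).
set E := _ + slide_energy.
have E0 : 0 <= E by rewrite addr_ge0 ?deletion_energy_ge0 ?slide_energy_ge0.
rewrite -mulrDr -[leRHS]mulrA [leRHS]mulrCA ler_wpM2l ?sqr_ge0 //.
have : c * E <= c ^+ 2 * E by rewrite ler_wpM2r // expr2 ler_peMl // ltW.
lra.
Qed.

End PermutationChain.

(** * Matchings encoded by permutations *)

Section Configurations.
Variables (V1 V2 : finType) (phi : V1 -> V2) (psi : V2 -> V1).
Hypotheses (phiK : cancel phi psi) (psiK : cancel psi phi).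
Implicit Types (s t : {perm V1}) (u x y z : V1) (M : {set V1 * V2}).

Definition graph s : {set V1 * V2} := [set e | e.2 == phi (s e.1)].
(* Every near-perfect matching arises from exactly one pair (s, u): its holes
   are u and phi (s u), and s restores the edge between them. *)
Definition near_graph s u := graph s :\ (u, phi (s u)).

Let phi_inj : injective phi := can_inj phiK.

Lemma in_graph s x v : ((x, v) \in graph s) = (v == phi (s x)).
Proof. by rewrite inE. Qed.

Lemma in_near_graph s u x v :
  ((x, v) \in near_graph s u) = (x != u) && (v == phi (s x)).
Proof.
rewrite !inE xpair_eqE /=; have [->|//] := eqVneq x u.
by case: eqP.
Qed.

Lemma graph_edge s e : e \in graph s -> e.2 = phi (s e.1).
Proof. by rewrite inE => /eqP. Qed.

Lemma graph_matching s M : M \subset graph s -> matching M.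
Proof.
move=> /subsetP Ms; apply/forall_inP => -[x v] /Ms/graph_edge/= vE.
apply/forall_inP => -[y v'] /Ms/graph_edge/= v'E; apply/implyP.
rewrite {}vE {}v'E xpair_eqE => /orP[/eqP->|]; first by rewrite !eqxx.
by rewrite (inj_eq phi_inj) (inj_eq perm_inj) => /eqP->; rewrite !eqxx.
Qed.

Lemma graph_perfect s : graph s \in perfect_matchings V1 V2.
Proof.
rewrite inE (graph_matching (subxx _)) /=; apply/andP; split.
  by apply/forallP => x; apply/existsP; exists (phi (s x)); rewrite in_graph.
apply/forallP => v; apply/existsP; exists (s^-1%g (psi v)).
by rewrite in_graph permKV psiK.
Qed.

Lemma perfect_graph M : M \in perfect_matchings V1 V2 -> exists s, M = graph s.
Proof.
rewrite inE => /and3P[mM /forallP M1 /forallP M2].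
have ex x : exists v, (x, v) \in M by apply/existsP/M1.
pose g x := psi (xchoose (ex x)).
have gM x : (x, phi (g x)) \in M by rewrite psiK (xchooseP (ex x)).
have uniqM e e' : e \in M -> e' \in M ->
    (e.1 == e'.1) || (e.2 == e'.2) -> e = e'.
  move=> eM e'M h; apply/eqP; have /forall_inP mMe := forall_inP mM e eM.
  exact: implyP (mMe e' e'M) h.
have g_inj : injective g.
  move=> x y gxy; have := uniqM _ _ (gM x) (gM y).
  by rewrite /= gxy eqxx orbT => /(_ isT)[].
exists (perm g_inj); apply/setP => -[x v]; rewrite in_graph permE.
apply/idP/eqP => [xM|->//].
by have := uniqM _ _ xM (gM x); rewrite /= eqxx => /(_ isT)[->].
Qed.

Lemma near_graph_near s u : near_graph s u \in near_matchings u (phi (s u)).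
Proof.
have card_graph : #|graph s| = #|V1|.
  rewrite -(card_imset xpredT (f := fun x => (x, phi (s x)))).
    apply: eq_card => -[x v]; rewrite in_graph.
    by apply/eqP/imsetP => [->|[y _ [-> ->]]]; first by exists x.
  by move=> x y [].
rewrite inE (graph_matching (subsetDl _ _)) /=; apply/and3P; split.
- by rewrite -card_graph [in X in _ == X](cardsD1 (u, phi (s u))) in_graph eqxx.
- apply/forallP => x; apply/eqP; have [->|xu] := eqVneq x u.
    by apply/existsP => -[v]; rewrite in_near_graph eqxx.
  by apply/negbF/existsP; exists (phi (s x)); rewrite in_near_graph xu /=.
apply/forallP => v; apply/eqP; have [->|vu] := eqVneq v (phi (s u)).
  apply/existsP => -[x].
  rewrite in_near_graph (inj_eq phi_inj) (inj_eq perm_inj).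
  by rewrite eq_sym andNb.
apply/negbF/existsP; exists (s^-1%g (psi v)).
rewrite in_near_graph permKV psiK eqxx andbT.
by apply: contra_neq vu => <-; rewrite permKV psiK.
Qed.

Lemma near_holes u v u' v' M : M \in near_matchings u v ->
  M \in near_matchings u' v' -> (u = u') * (v = v').
Proof.
rewrite !inE => /and4P[_ _ /forallP h1 /forallP h2].
move=> /and4P[_ _ /forallP h1' /forallP h2'].
split.
  by have := h1' u; rewrite (eqP (h1 u)) eqxx => /eqP/esym/eqP.
by have := h2' v; rewrite (eqP (h2 v)) eqxx => /eqP/esym/eqP.
Qed.

Lemma near_not_perfect u v M : M \in near_matchings u v ->
  M \notin perfect_matchings V1 V2.
Proof.
rewrite !inE => /and4P[_ _ /forallP/(_ u) h _].
apply/and3P => -[_ /forallP/(_ u)].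
by move: h; rewrite eqxx => /eqP/negPf->.
Qed.

Lemma near_graph_not_perfect s u :
  near_graph s u \notin perfect_matchings V1 V2.
Proof. exact/near_not_perfect/near_graph_near. Qed.

(** Adding the edge between the holes yields a perfect matching, whose permutation is [s]. *)
Lemma near_matching_graph u v M : M \in near_matchings u v ->
  exists2 s : {perm V1}, phi (s u) = v & M = near_graph s u.
Proof.
move=> Mn; have := Mn.
rewrite inE => /and4P[/forall_inP mM _ /forallP M1 /forallP M2].
have uM (y : V2) : (u, y) \notin M.
  have := M1 u; rewrite eqxx => /eqP/negP nu; apply/negP => uy.
  by apply: nu; apply/existsP; exists y.
have vM (x : V1) : (x, v) \notin M.
  have := M2 v; rewrite eqxx => /eqP/negP nv; apply/negP => xv.
  by apply: nv; apply/existsP; exists x.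
have [|s Ms] := @perfect_graph ((u, v) |: M).
  rewrite inE; apply/and3P; split.
  - apply/forall_inP => e /setU1P[->|eM];
      apply/forall_inP => e' /setU1P[->|e'M].
    + by rewrite !eqxx.
    + apply/implyP => /= /orP[] /eqP h; move: e'M.
        by rewrite [e']surjective_pairing -h (negPf (uM _)).
      by rewrite [e']surjective_pairing -h (negPf (vM _)).
    + apply/implyP => /= /orP[] /eqP h; move: eM.
        by rewrite [e]surjective_pairing h (negPf (uM _)).
      by rewrite [e]surjective_pairing h (negPf (vM _)).
    + by have /forall_inP mMe := mM e eM; apply: mMe.
  - apply/forallP => x; apply/existsP; have [->|xu] := eqVneq x u.
      by exists v; rewrite setU11.
    have := M1 x; rewrite (negPf xu) => /eqP/negbFE/existsP[y xy].
    by exists y; rewrite inE xy orbT.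
  - apply/forallP => y; apply/existsP; have [->|yv] := eqVneq y v.
      by exists u; rewrite setU11.
    have := M2 y; rewrite (negPf yv) => /eqP/negbFE/existsP[x xy].
    by exists x; rewrite inE xy orbT.
have su : v = phi (s u) by apply/eqP; rewrite -in_graph -Ms setU11.
by exists s => //; rewrite /near_graph -su -Ms setU1K ?uM.
Qed.

Lemma graph_inj : injective graph.
Proof.
move=> s t /setP st; apply/permP => x; apply: phi_inj; apply/eqP.
by rewrite -in_graph -st in_graph.
Qed.

Definition configuration (a : {perm V1} * option V1) : {set V1 * V2} :=
  if a.2 is Some u then near_graph a.1 u else graph a.1.

(** The holes determine [u] and [s u], and the remaining edges the other values of [s]. *)
Lemma configuration_inj : injective configuration.
Proof.
move=> [s [u|]] [t [z|]]; rewrite /configuration /= => st.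
- have := near_graph_near t z.
  rewrite -st => /near_holes/(_ (near_graph_near s u)).
  case=> zu /phi_inj tu; congr (_, _); last by rewrite zu.
  apply/permP => x; have [->|xu] := eqVneq x u; first by rewrite -tu zu.
  apply: phi_inj; apply/eqP; move/setP/(_ (x, phi (s x))): st.
  by rewrite !in_near_graph zu xu eqxx => /esym.
- by have := near_graph_not_perfect s u; rewrite st graph_perfect.
- by have := near_graph_not_perfect t z; rewrite -st graph_perfect.
- by rewrite (graph_inj st).
Qed.

Lemma OmegaP M :
  reflect (exists a, configuration a = M) (M \in Omega V1 V2).
Proof.
apply: (iffP setUP) => [[/perfect_graph[s ->]|]|[[s [u|]] <-]].
- by exists (s, None).
- move=> /bigcupP[u _ /bigcupP[v _ /near_matching_graph[s _ ->]]].
  by exists (s, Some u).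
- right; apply/bigcupP; exists u => //; apply/bigcupP; exists (phi (s u)) => //.
  exact: near_graph_near.
- by left; apply: graph_perfect.
Qed.

Lemma configuration_Omega a : configuration a \in Omega V1 V2.
Proof. by apply/OmegaP; exists a. Qed.

Definition config_state a : state V1 V2 :=
  Sub (configuration a) (configuration_Omega a).

Lemma config_state_inj : injective config_state.
Proof. by move=> a b /(congr1 val); apply: configuration_inj. Qed.

Lemma config_state_bij : bijective config_state.
Proof.
have surj (st : state V1 V2) : exists a, config_state a == st.
  have /OmegaP[a aM] := valP st; exists a.
  by apply/eqP/val_inj.
exists (fun st => xchoose (surj st)) => [a|st].
  exact: config_state_inj (eqP (xchooseP (surj _))).
exact: eqP (xchooseP (surj _)).
Qed.

Lemma sum_states (R : realFieldType) (g : state V1 V2 -> R) :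
  \sum_st g st = \sum_s g (config_state (s, None)) +
                 \sum_s \sum_u g (config_state (s, Some u)).
Proof.
rewrite (reindex config_state); last exact: onW_bij config_state_bij.
rewrite (eq_bigr (fun a => g (config_state (a.1, a.2)))) => [|[]//].
rewrite -big_split -(pair_bigA _ (fun s o => g (config_state (s, o)))).
apply: eq_bigr => s _ /=; rewrite (bigD1 None) //=; congr (_ + _).
rewrite (reindex_omap Some id) //=; last by case.
by apply: eq_bigl => u; rewrite eqxx.
Qed.

Lemma adjacent_deletion s u : adjacent (graph s) (near_graph s u).
Proof.
rewrite /adjacent /deletion graph_perfect; apply/orP; left => /=.
by apply/exists_inP; exists (u, phi (s u)); rewrite ?in_graph.
Qed.

Lemma adjacent_slide s u z : z != u ->
  adjacent (near_graph s u) (near_graph (tperm u z * s)%g u).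
Proof.
move=> zu; apply/or3P/Or33/existsP; exists u; apply/existsP; exists (phi (s u)).
rewrite near_graph_near; apply/exists_inP; exists (z, phi (s z)).
  by rewrite in_near_graph zu /=.
apply/orP; left; apply/eqP/setP => -[x v]; rewrite in_near_graph.
rewrite in_setU1 in_setD1 in_near_graph !xpair_eqE permM /=.
have [->|xu] := eqVneq x u; first by rewrite [u == z]eq_sym (negPf zu).
have [->|xz] := eqVneq x z.
  by rewrite tpermR /=; case: eqP => //=; case: eqP.
by rewrite tpermD // eq_sym.
Qed.

End Configurations.

(** * Transfer to the boosted chain *)

Section PoincareInequality.
Variables (R : realType) (V1 V2 : finType) (phi : V1 -> V2) (psi : V2 -> V1).
Hypotheses (phiK : cancel phi psi) (psiK : cancel psi phi).
Variables (lam w : V1 * V2 -> R) (c : R).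
Hypotheses (lam_gt0 : forall e, 0 < lam e) (w_gt0 : forall h, 0 < w h).
Hypotheses (c_ge1 : 1 <= c) (w_rough : rough c lam w).
Hypothesis V1_gt0 : (0 < #|V1|)%N.

Notation n := (#|V1|%:R : R).
Let lamT e := lam (e.1, phi e.2).
Let wT h := w (h.1, phi h.2).
Notation conf := (config_state phiK psiK).

Let lamT_gt0 e : 0 < lamT e. Proof. exact: lam_gt0. Qed.
Let wT_gt0 e : 0 < wT e. Proof. exact: w_gt0. Qed.
Let phi_inj : injective phi := can_inj phiK.

Lemma activity_graph s : activity lam (graph phi s) = act lamT s.
Proof.
rewrite /activity /act /lamT /=.
have -> : graph phi s = [set (x, phi (s x)) | x : V1].
  apply/setP => -[x v]; rewrite in_graph.
  by apply/eqP/imsetP => [->|[y _ [-> ->]]]; first by exists x.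
by rewrite big_imset //= => x y _ _ [].
Qed.

Lemma activity_near_graph s u :
  activity lam (near_graph phi s u) = act lamT s / lamT (u, s u).
Proof.
rewrite -activity_graph /activity.
rewrite [in RHS](big_setD1 (u, phi (s u))) ?in_graph //=.
by rewrite mulrAC divff ?mul1r // gt_eqF.
Qed.

Lemma total_perfect :
  total_activity lam (perfect_matchings V1 V2) = total_act lamT.
Proof.
rewrite /total_activity /total_act.
have -> : perfect_matchings V1 V2 = [set graph phi s | s : {perm V1}].
  apply/setP => M; apply/idP/imsetP => [/(perfect_graph psiK)[s ->]|[s _ ->]].
    by exists s.
  exact: (graph_perfect phiK psiK).
rewrite big_imset /=; last by move=> s t _ _; apply: graph_inj phiK _ _.
by apply: eq_bigr => s _; rewrite activity_graph.
Qed.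

Lemma total_near u x :
  total_activity lam (near_matchings u (phi x)) =
  edge_act lamT u x / lamT (u, x).
Proof.
rewrite /total_activity /edge_act mulr_suml.
have -> : near_matchings u (phi x) =
    [set near_graph phi s u | s in [set s : {perm V1} | s u == x]].
  apply/setP => M; apply/idP/imsetP => [|[s]].
    move=> /(near_matching_graph psiK)[s /phi_inj su ->].
    by exists s; rewrite ?inE ?su.
  by rewrite inE => /eqP <- ->; apply: (near_graph_near phiK psiK).
rewrite big_imset /=; last first.
  move=> s t _ _ st; have /(configuration_inj phiK psiK)[//] :
    configuration phi (s, Some u) = configuration phi (t, Some u) by [].
rewrite big_set /=; apply: eq_bigr => s /eqP <-.
exact: activity_near_graph.
Qed.

Lemma rough_bounds u x :
  c^-1 * total_act lamT <= wT (u, x) * (edge_act lamT u x / lamT (u, x)) <=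
  c * total_act lamT.
Proof.
have := w_rough (u, phi x).
rewrite /ideal_hole_weight /= total_perfect total_near.
have L0 := total_act_gt0 lamT_gt0.
by rewrite invf_div mulrA ler_pdivlMr // ler_pdivrMr.
Qed.

Lemma boosted_weight_graph s :
  boosted_weight lam w (graph phi s) = n ^+ 2 * act lamT s.
Proof.
by rewrite /boosted_weight (graph_perfect phiK psiK) activity_graph.
Qed.

Lemma boosted_weight_near_graph s u :
  boosted_weight lam w (near_graph phi s u) = near_weight lamT wT s u.
Proof.
rewrite /boosted_weight (negPf (near_graph_not_perfect phiK psiK s u)).
rewrite (big_pred1 (u, phi (s u))) => [|[x v] /=].
  by rewrite activity_near_graph.
have near := near_graph_near phiK psiK s u; rewrite xpair_eqE.
apply/idP/andP => [/(near_holes near)[-> ->]|[/eqP -> /eqP ->]] //.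
Qed.

Let W (st : state V1 V2) := boosted_weight lam w (val st).
Let Z := \sum_st W st.
Let pi := boosted_pi lam w.

Let W_perfect s : W (conf (s, None)) = n ^+ 2 * act lamT s.
Proof. exact: boosted_weight_graph. Qed.

Let W_near s u : W (conf (s, Some u)) = near_weight lamT wT s u.
Proof. exact: boosted_weight_near_graph. Qed.

Let W_gt0 st : 0 < W st.
Proof.
have [g gK Kg] := config_state_bij phiK psiK; rewrite -(Kg st).
case: (g st) => s [u|]; first by rewrite W_near near_weight_gt0.
by rewrite W_perfect mulr_gt0 ?act_gt0 // exprn_gt0 // ltr0n.
Qed.

Let Z_gt0 : 0 < Z.
Proof.
rewrite /Z (bigD1 (conf (perm_one V1, None))) //= ltr_pwDl //.
by rewrite sumr_ge0 // => st _; apply: ltW.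
Qed.

Let piE st : pi st = W st / Z. Proof. by []. Qed.
Let pi_sum : \sum_st pi st = 1.
Proof. by rewrite /pi /boosted_pi -mulr_suml divff // gt_eqF. Qed.

(** The mean minimises the mean square deviation, so any centre [a] may be used; it will be the
    average over perfect matchings. *)
Lemma variance_le (f : state V1 V2 -> R) a :
  variance pi f <= Z^-1 * \sum_st W st * (f st - a) ^+ 2.
Proof.
rewrite mulr_sumr [leRHS](_ : _ = variance pi f + (mean pi f - a) ^+ 2).
  by rewrite lerDl sqr_ge0.
set m := mean pi f.
rewrite (eq_bigr (fun st => pi st * (f st - m) ^+ 2 +
  2 * (m - a) * (pi st * f st) + (a ^+ 2 - m ^+ 2) * pi st)) => [|st _];
  last by rewrite piE; ring.
rewrite !big_split -!mulr_sumr /= pi_sum -/(mean pi f) -/m /variance -/m.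
by ring.
Qed.

Let flow (f : state V1 V2 -> R) st st' :=
  pi st * boosted_JSV lam w st st' * (f st - f st') ^+ 2.

Let flow_adjacent f st st' : adjacent (val st) (val st') ->
  flow f st st' =
    (4 * n * Z)^-1 * (Num.min (W st) (W st') * (f st - f st') ^+ 2).
Proof.
move=> adj; rewrite /flow /boosted_JSV; have [->|_] := eqVneq st st'.
  by rewrite subrr expr0n !mulr0.
rewrite /boosted_move adj -/pi !piE.
have Wst := W_gt0 st; have Wst' := W_gt0 st'.
have n0 : n != 0 by rewrite pnatr_eq0 -lt0n.
have -> : Num.min 1 (W st' / Z / (W st / Z)) = Num.min (W st) (W st') / W st.
  rewrite -[X in Num.min X _](divff (lt0r_neq0 Wst)).
  rewrite minr_pMl ?invr_ge0 1?ltW //; congr Num.min.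
  by field; rewrite !gt_eqF.
by field; rewrite n0 !gt_eqF.
Qed.

Let flow_ge0 f st st' : 0 <= flow f st st'.
Proof.
have [adj|nadj] := boolP (adjacent (val st) (val st')).
  rewrite flow_adjacent //; apply: mulr_ge0.
    by rewrite invr_ge0 !mulr_ge0 // ltW.
  by rewrite mulr_ge0 ?sqr_ge0 // le_min !ltW.
rewrite /flow /boosted_JSV; have [->|_] := eqVneq st st'.
  by rewrite subrr expr0n mulr0.
by rewrite /boosted_move (negPf nadj) mulr0 mul0r.
Qed.

(** The 8 is the 4 of the proposal probability times the 2 of the Dirichlet form. Distinct [u] or
    [z] lead to distinct targets, so the energies are partial sums of nonnegative flows. *)
Lemma dirichlet_ge f :
  (8 * n * Z)^-1 *
    (deletion_energy lamT wT
       (fun s => f (conf (s, None))) (fun s u => f (conf (s, Some u))) +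
     slide_energy lamT wT (fun s u => f (conf (s, Some u)))) <=
  dirichlet (boosted_JSV lam w) pi f.
Proof.
rewrite (_ : (8 * n * Z)^-1 = 2^-1 * (4 * n * Z)^-1); last first.
  by rewrite -invfM; congr _^-1; ring.
rewrite /dirichlet -mulrA ler_pM2l ?invr_gt0 // mulrDr.
rewrite -[leRHS]/(\sum_x \sum_y flow f x y) (sum_states phiK psiK).
apply: lerD.
  rewrite mulr_sumr; apply: ler_sum => s _; rewrite mulr_sumr.
  apply: (sum_le_inj (h := fun u => conf (s, Some u))) => //.
    by move=> u z /config_state_inj[].
  move=> u _; rewrite flow_adjacent ?W_perfect ?W_near //.
  exact: (adjacent_deletion phiK psiK).
rewrite /slide_energy exchange_big mulr_sumr; apply: ler_sum => s _.
rewrite mulr_sumr; apply: ler_sum => u _; rewrite mulr_sumr.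
apply: (sum_le_inj (h := fun z => conf ((tperm u z * s)%g, Some u))) => //.
  move=> y z /config_state_inj[] /mulIg /permP/(_ u).
  by rewrite !tpermL.
move=> z _; have [->|zu] := eqVneq z u.
  by rewrite tperm1 mul1g subrr expr0n !mulr0 flow_ge0.
rewrite flow_adjacent ?W_near //.
exact: (adjacent_slide phiK psiK).
Qed.

(** The 120 is the 15 of [permutation_poincare] times the 8 of [dirichlet_ge]. *)
Lemma boosted_poincare :
  poincare (boosted_JSV lam w) (boosted_pi lam w) (120 * c ^+ 2 * n ^+ 3).
Proof.
move=> f; pose f0 s := f (conf (s, None)); pose F s u := f (conf (s, Some u)).
have n_ge1 : 1 <= n by rewrite ler1n.
have := permutation_poincare lamT_gt0 wT_gt0 c_ge1 rough_bounds f0 F n_ge1.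
set avg := _ / total_act lamT; set E := _ + slide_energy _ _ _ => main.
apply: (le_trans (variance_le f avg)).
have c2n0 : 0 <= 120 * c ^+ 2 * n ^+ 3.
  by rewrite !mulr_ge0 ?exprn_ge0 // (le_trans _ c_ge1).
apply: le_trans (ler_wpM2l c2n0 (dirichlet_ge f)); rewrite -/f0 -/F -/E.
have -> : 120 * c ^+ 2 * n ^+ 3 * ((8 * n * Z)^-1 * E) =
    Z^-1 * (15 * c ^+ 2 * n ^+ 2 * E).
  by field; rewrite gt_eqF ?pnatr_eq0 -?lt0n.
rewrite ler_pM2l ?invr_gt0 //; apply: le_trans main.
rewrite (sum_states phiK psiK) mulr_sumr lerD //.
  by apply: ler_sum => s _; rewrite W_perfect mulrA.
by apply: ler_sum => s _; apply: ler_sum => u _; rewrite W_near.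
Qed.

End PoincareInequality.

Theorem lemma5 (R : realType) (c : R) (hc : 1 <= c) :
  exists C : R,
    forall (n : nat) (V1 V2 : finType),
      (2 <= n)%N -> #|V1| = n -> #|V2| = n ->
    forall lam w : V1 * V2 -> R,
      (forall e, 0 < lam e) -> (forall h, 0 < w h) -> rough c lam w ->
      (relaxation_time (boosted_JSV lam w) (boosted_pi lam w)
         <= (C * n%:R ^+ 3 * ln n%:R)%:E)%E.
Proof.
(* Dividing the Poincare constant by [ln 2] makes up for the factor [ln n], which is at least
   [ln 2]. *)
exists (120 * c ^+ 2 / ln 2) => n V1 V2 n_ge2 V1n V2n lam w.
move=> lam_gt0 w_gt0 w_rough.
have V12 : #|V1| = #|V2| by rewrite V1n.
pose phi x : V2 := enum_val (cast_ord V12 (enum_rank x)).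
pose psi y : V1 := enum_val (cast_ord (esym V12) (enum_rank y)).
have phiK : cancel phi psi.
  by move=> x; rewrite /psi /phi enum_valK cast_ordK enum_rankK.
have psiK : cancel psi phi.
  by move=> y; rewrite /psi /phi enum_valK cast_ordKV enum_rankK.
have V1_gt0 : (0 < #|V1|)%N by rewrite V1n ltnW.
have := boosted_poincare phiK psiK lam_gt0 w_gt0 hc w_rough V1_gt0.
rewrite V1n => gap; have c_gt0 : 0 < c by apply: lt_le_trans hc.
have ln2_gt0 : 0 < ln 2 :> R by rewrite ln_gt0 // ltr1n.
apply: (@le_trans _ _ (120 * c ^+ 2 * n%:R ^+ 3)%:E).
  apply: ereal_inf_lbound; exists (120 * c ^+ 2 * n%:R ^+ 3) => //; split=> //.
  by rewrite !mulr_gt0 ?exprn_gt0 // ltr0n ltnW.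
rewrite lee_fin.
rewrite [leRHS](_ : _ = 120 * c ^+ 2 * n%:R ^+ 3 * (ln n%:R / ln 2));
  last by ring.
apply: ler_peMr; first by rewrite !mulr_ge0 ?exprn_ge0 // ltW.
rewrite ler_pdivlMr // mul1r.
by rewrite ler_ln ?posrE ?ltr0n ?ler_nat // ltnW.
Qed.
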